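(* Let $m$ be an odd integer that is cube-free. If $G$ is a finite group of order $m$ or $2m$, then $G$ has a basis.
   Context: An integer $m$ is cube-free if $p^3$ does not divide $m$ for every prime $p$. Basis: Let $G$ be a finite group with identity $e$, and write $|b|$ for the order of an element $b$. A tuple $(b_1,\ldots,b_n) \in (G\setminus\{e\})^n$ is a basis for $G$ if for every $g \in G$ there is a unique tuple $(a_1,\ldots,a_n)$ with $a_i \in \{0,\ldots,|b_i|-1\}$ for all $i$ such that $g = b_1^{a_1}\cdots b_n^{a_n}$ (the product taken in this order). The trivial group $\{e\}$ is said to have a trivial basis (the empty tuple), and so counts as having a basis. *)

(* Defs.v *)
From mathcomp Require Import all_boot all_fingroup.

Set Implicit Arguments.
Unset Strict Implicit.
Unset Printing Implicit Defensive.

Definition cube_free (m : nat) : Prop :=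
  forall p : nat, prime p -> ~~ (p ^ 3 %| m).

Section Basis.

Variable gT : finGroupType.
Local Open Scope group_scope.

(* [\prod_(i < n)] multiplies in increasing order of [i].  [G^#] is [G] minus
   the identity, so the case [n = 0] is the trivial basis of the trivial
   group. *)
Definition is_basis (G : {group gT}) (n : nat) (b : n.-tuple gT) : Prop :=
  (forall i : 'I_n, tnth b i \in G^#) /\
  (forall g : gT, g \in G ->
     exists! a : n.-tuple nat,
       (forall i : 'I_n, tnth a i < #[tnth b i])%N /\
       g = \prod_(i < n) tnth b i ^+ tnth a i).

Definition has_basis (G : {group gT}) : Prop :=
  exists (n : nat) (b : n.-tuple gT), is_basis G b.

End Basis.

(* Main.v *)
Require Import Defs.
From mathcomp Require Import all_boot all_fingroup.
From mathcomp Require Import ssralg all_solvable.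

(* Let [p] be the smallest prime divisor of #|G| and [P] a Sylow [p]-subgroup, so
   that [P] is abelian of order [p] or [p ^ 2].  A [q]-group with [q > p]
   normalising [P] centralises it, since [4] does not divide #|G|; hence [P] is
   central in its normaliser and Burnside's transfer theorem gives a normal
   complement [K] of [P].  Concatenating a basis of [K], which exists by
   induction on the order, with a basis of [P] gives a basis of [G]. *)

Set Implicit Arguments.
Unset Strict Implicit.
Unset Printing Implicit Defensive.

Section Burnside.

Local Open Scope group_scope.

Variables (gT : finGroupType) (p : nat) (G P : {group gT}).
Hypotheses (sylP : p.-Sylow(G) P) (nPcP : 'N_G(P) \subset 'C(P)).

Let sPG : P \subset G := pHall_sub sylP.

Let cPP : abelian P.
Proof. by apply: subset_trans nPcP; rewrite subsetI sPG normG. Qed.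

(* [P] and [P :^ y] are both Sylow in 'C_G[x ^ y], hence conjugate there, so
   that [y] agrees with an element of 'N_G(P) in its action on [x]. *)
Lemma Sylow_central_fusion x y :
  x \in P -> y \in G -> x ^ y \in P -> x ^ y = x.
Proof.
move=> Px Gy Pxy; pose C := 'C_G[x ^ y]%G.
have sylC (Q : {group gT}) :
    p.-Sylow(G) Q -> Q \subset 'C[x ^ y] -> p.-Sylow(C) Q.
  move=> sylQ cQ; apply: (pHall_subl _ (subsetIl _ _) sylQ).
  by rewrite subsetI (pHall_sub sylQ).
have sylPC : p.-Sylow(C) P.
  by apply: sylC => //; rewrite sub_cent1 (subsetP cPP).
have sylPyC : p.-Sylow(C) (P :^ y).
  apply: sylC; first by rewrite pHallJ.
  rewrite -cent_set1 -conjg_set1 centJ conjSg cent_set1.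
  by rewrite sub_cent1 (subsetP cPP).
have [c /setIP[Gc /cent1P cxy] /= defP] := Sylow_trans sylPC sylPyC.
have Nyc : y * c^-1 \in 'N_G(P).
  rewrite inE groupM ?groupV //=; apply/normP.
  by rewrite conjsgM defP conjsgK.
have /centP/(_ _ Px) := subsetP nPcP _ Nyc.
move/esym/commgP/conjg_fixP; rewrite conjgM => {2}<-.
by rewrite [RHS]conjgE invgK mulgA cxy mulgK.
Qed.

(* By the fusion lemma the transfer into [P] maps [g] in [P] to [g ^+ #|G : P|],
   so it is injective on [P] and its kernel complements [P]. *)
Lemma normal_complement_of_central_Sylow :
  exists2 K : {group gT}, K <| G & K * P = G /\ K :&: P = 1.
Proof.
have abP : abelian (idm P @* P) by rewrite morphim_idm.
(* The orbit length of the coset [P :* x] under right multiplication by [<[g]>]; over orbit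
   representatives these lengths sum to [#|G : P|]. *)
pose n x g := #|<[g]> : P :* x|.
have fusion g x : g \in P -> x \in G -> (g ^+ n x g) ^ x^-1 = g ^+ n x g.
  move=> Pg Gx; apply: Sylow_central_fusion; rewrite ?groupX ?groupV //.
  (* [g ^+ n x g] fixes the coset [P :* x], so its conjugate by [x^-1] lies in [P], as the fusion
     lemma requires. *)
  have := mulg_exp_card_rcosets P g x.
  by rewrite mem_rcoset -/(n x g) conjgE invgK mulgA.
pose t := transfer_morphism G abP.
have tP g : g \in P -> t g = (FiniteModule.fmod abP g *+ #|G : P|)%R.
  move=> Pg; have Gg := subsetP sPG g Pg.
  have trX := transversalP (rcosets_cycle_partition sPG Gg).
  rewrite /= (transfer_cycle_expansion sPG abP Gg trX).
  rewrite -(sum_index_rcosets_cycle sPG Gg trX) -GRing.sumrMnr.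
  apply: eq_bigr => x Xx.
  rewrite -/(n x g) fusion ?(subsetP (transversal_sub trX)) // /restrm /=.
  by rewrite FiniteModule.fmodX //= morphim_idm.
pose K : {group gT} := [group of 'ker t].
have tiKP : K :&: P = 1.
  apply/trivgP/subsetP=> g /setIP[/mker Kg Pg]; rewrite inE.
  move: Kg; rewrite tP // => /(congr1 val).
  rewrite [val _]FiniteModule.fmvalZ FiniteModule.fmodK /= ?morphim_idm // => g1.
  (* The order of [g] divides the coprime numbers [#|P|] and [#|G : P|]. *)
  rewrite -order_eq1 -dvdn1 -(eqnP (_ : coprime #|P| #|G : P|)).
    by rewrite dvdn_gcd order_dvdG // order_dvdn g1 /=.
  by case/and3P: sylP => _ pP; apply: pnat_coprime.
have cardT : #|t @* G| <= #|P|.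
  have sT : t @* G \subset FiniteModule.fmod abP @: P.
    apply/subsetP=> u _; apply/imsetP; exists (val u).
      by have := FiniteModule.fmodP u; rewrite /= morphim_idm.
    by rewrite FiniteModule.fmvalK.
  by apply: leq_trans (subset_leq_card sT) (leq_imset_card _ _).
have nsKG : K <| G by apply: ker_normal.
exists K; first by [].
(* By counting: [#|K * P| = #|K| * #|P|], while [#|G : K|] is the order of the image of [t], at most
   [#|P|]. *)
split=> //; apply/eqP; rewrite eqEcard mul_subG ?(normal_sub nsKG) ?TI_cardMg //=.
rewrite -(Lagrange (normal_sub nsKG)) leq_mul2l -card_quotient ?normal_norm //.
by rewrite (card_isog (first_isog t)) cardT orbT.
Qed.

End Burnside.

Section SmallSylow.

Variable gT : finGroupType.
Implicit Types G P Q : {group gT}.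
Local Open Scope group_scope.

(* The number of points of [P] fixed by [Q] is congruent to #|P| mod [q], and
   no [q > p] divides [p - 1], [p ^ 2 - p] or, unless [p = 2], [p ^ 2 - 1]. *)
Lemma pgroup_rank2_cent p q P Q :
    prime p -> prime q -> p < q -> p.-group P -> q.-group Q ->
    logn p #|P| <= 2 -> ~~ (4 %| #|P|) -> Q \subset 'N(P) ->
  Q \subset 'C(P).
Proof.
move=> p_pr q_pr ltpq pP qQ leP2 no4 nPQ.
have p_gt1 := prime_gt1 p_pr.
have actsQP : [acts Q, on P | 'J] by rewrite astabsJ.
have := pgroup_fix_mod qQ actsQP; rewrite afixJ.
have oP := card_pgroup pP; set k := logn p _ in leP2 oP.
have sCP : P :&: 'C(Q) \subset P := subsetIl _ _.
have oC := card_pgroup (pgroupS sCP pP); set j := logn p _ in oC.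
have lejk : j <= k by apply/dvdn_leq_log/cardSg.
have [eqjk _|neqjk] := eqVneq j k.
  rewrite centsC; apply/setIidPl/eqP.
  by rewrite eqEcard sCP oC oP eqjk /=.
rewrite oC oP => /eqP; rewrite eqn_mod_dvd ?leq_pexp2l ?(ltnW p_gt1) //.
have ndvd1 : ~~ (q %| p.-1).
  by rewrite gtnNdvd ?(leq_ltn_trans (leq_pred p)) // -ltnS prednK // ltnW.
have ndvdp : ~~ (q %| p) by rewrite gtnNdvd // prime_gt0.
have p2E : p ^ 2 - p ^ 1 = (p * p.-1)%N by rewrite -subn1 mulnBr muln1.
have p21E : p ^ 2 - p ^ 0 = (p.-1 * p.+1)%N by rewrite (subn_sqr p 1) addn1 subn1.
case: k leP2 lejk neqjk oP => [|[|[|]]] //; case: j oC => [|[|[|?]]] // oC _ _ _ oP.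
- by rewrite expn1 expn0 subn1 (negPf ndvd1).
(* Now [q] divides [p.+1] and exceeds [p], so [q = p.+1]; consecutive primes are 2 and 3, which
   makes [#|P|] equal to 4. *)
- rewrite p21E Euclid_dvdM // (negPf ndvd1) /= => /dvdn_leq.
  move/(_ isT) => leqp; have eqp : q = p.+1 by apply/eqP; rewrite eqn_leq leqp.
  case/negP: no4; rewrite oP; have [-> //|p_odd] := even_prime p_pr.
  have [q2|] := even_prime q_pr; last by rewrite eqp /= p_odd.
  by move: p_gt1; rewrite -ltnS -eqp q2.
by rewrite p2E Euclid_dvdM // (negPf ndvd1) (negPf ndvdp).
Qed.

(** ['N_G(P)] is generated by its Sylow subgroups. Those for [p] lie in the abelian group [P]; those
    for another prime [q] fall under the previous lemma, as minimality of [p] gives [p < q]. *)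
Lemma pdiv_Sylow_central p G P :
    p.-Sylow(G) P -> 1 < #|G| -> p = pdiv #|G| ->
    logn p #|P| <= 2 -> ~~ (4 %| #|P|) ->
  'N_G(P) \subset 'C(P).
Proof.
move=> sylP ntG defp leP2 no4.
have p_pr : prime p by rewrite defp pdiv_prime.
have pP := pHall_pgroup sylP.
have sPN : P \subset 'N_G(P) by rewrite subsetI (pHall_sub sylP) normG.
have nPN : P <| 'N_G(P) by rewrite /normal sPN subsetIr.
have sylPN := pHall_subl sPN (subsetIl _ _) sylP.
rewrite -['N_G(P)]Sylow_gen gen_subG.
apply/bigcupsP=> Q /SylowP[q q_pr sylQ].
have qQ := pHall_pgroup sylQ; have sQN := pHall_sub sylQ.
have [eqpq|neqpq] := eqVneq q p.
  have sQP : Q \subset P by rewrite (sub_normal_Hall sylPN) // -eqpq.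
  exact: subset_trans sQP (p2group_abelian pP leP2).
(* If [Q] is trivial, [q] need not divide [#|G|] and may be smaller than [p]. *)
have [-> | ntQ] := eqVneq (Q : {set gT}) 1; first exact: sub1G.
apply: (pgroup_rank2_cent p_pr q_pr) => //; last first.
  exact: subset_trans sQN (subsetIr _ _).
have [_ qdQ _] := pgroup_pdiv qQ ntQ.
rewrite ltn_neqAle eq_sym neqpq defp pdiv_min_dvd ?prime_gt1 //.
by apply: dvdn_trans qdQ (cardSg (subset_trans sQN (subsetIl _ _))).
Qed.

End SmallSylow.

Section BasisProducts.

Variable gT : finGroupType.
Implicit Types G H K : {group gT}.
Local Open Scope group_scope.

Lemma has_basis1 G : G :=: 1 -> has_basis G.
Proof.
move=> G1; exists 0, [tuple]; split=> [[]//|g]; rewrite G1 => /set1P->.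
exists [tuple]; split=> [|a _]; first by split=> [[]//|]; rewrite big_ord0.
by rewrite (tuple0 a).
Qed.

Lemma has_basis_cycle G x : G :=: <[x]> -> has_basis G.
Proof.
move=> Gx; have [x1|ntx] := eqVneq x 1.
  by apply: has_basis1; rewrite Gx x1 cycle1.
exists 1%N, [tuple x]; split=> [i|g].
  by rewrite (ord1 i) (tnth_nth 1) !inE ntx Gx cycle_id.
rewrite Gx => /cyclePmin[n ltn ->].
exists [tuple n]; split=> [|a [lta]].
  split=> [i|]; first by rewrite (ord1 i) !(tnth_nth 0).
  by rewrite big_ord1 !(tnth_nth 0).
have := lta ord0; rewrite big_ord1 !(tnth_nth 1) /= => lt0 /eqP.
rewrite eq_expg_mod_order !modn_small // => /eqP eqn.
by apply: eq_from_tnth => i; rewrite (ord1 i) {1}(tnth_nth 0).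
Qed.

(** Every element of [G] factors uniquely as [x * y] with [x] in [K] and [y] in [H]; its exponents
    over [b1 ++ b2] are those of [x] followed by those of [y]. *)
Lemma has_basis_mulg G K H :
  K * H = G -> K :&: H = 1 -> has_basis K -> has_basis H -> has_basis G.
Proof.
move=> defG tiKH [n1 [b1 [b1K bK]]] [n2 [b2 [b2H bH]]].
have sKG : K \subset G by rewrite -defG mulG_subl.
have sHG : H \subset G by rewrite -defG mulG_subr.
have prodK (a : n1.-tuple nat) : \prod_(i < n1) tnth b1 i ^+ tnth a i \in K.
  by apply: group_prod => i _; rewrite groupX //; case/setD1P: (b1K i).
have prodH (a : n2.-tuple nat) : \prod_(i < n2) tnth b2 i ^+ tnth a i \in H.
  by apply: group_prod => i _; rewrite groupX //; case/setD1P: (b2H i).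
exists (n1 + n2), [tuple of b1 ++ b2]; split=> [i|g].
  rewrite -(splitK i); case: (split i) => j /=; rewrite ?tnth_lshift ?tnth_rshift.
    by apply: subsetP (b1K j); rewrite setSD.
  by apply: subsetP (b2H j); rewrite setSD.
rewrite -defG => /mulsgP[x y Kx Hy ->].
have [a1 [[lt1 def_x] uniq1]] := bK x Kx.
have [a2 [[lt2 def_y] uniq2]] := bH y Hy.
exists [tuple of a1 ++ a2]; split=> [|a [lta]].
  split=> [i|].
    rewrite -(splitK i).
    by case: (split i) => j /=; rewrite ?tnth_lshift ?tnth_rshift.
  rewrite big_split_ord {1}def_x {1}def_y /=; congr (_ * _).
    by apply: eq_bigr => i _; rewrite !tnth_lshift.
  by apply: eq_bigr => i _; rewrite !tnth_rshift.
pose c1 := [tuple tnth a (lshift n2 i) | i < n1].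
pose c2 := [tuple tnth a (rshift n1 i) | i < n2].
have -> : \prod_(i < n1 + n2) tnth [tuple of b1 ++ b2] i ^+ tnth a i =
    (\prod_(i < n1) tnth b1 i ^+ tnth c1 i) *
    (\prod_(i < n2) tnth b2 i ^+ tnth c2 i).
  rewrite big_split_ord /=; congr (_ * _).
    by apply: eq_bigr => i _; rewrite tnth_lshift tnth_mktuple.
  by apply: eq_bigr => i _; rewrite tnth_rshift tnth_mktuple.
move=> eqxy.
(* [remgr K H] recovers the [H]-factor of a product; cancelling it then gives the [K]-factor. *)
have eqy : y = \prod_(i < n2) tnth b2 i ^+ tnth c2 i.
  by rewrite -(remgrMid tiKH Kx Hy) eqxy remgrMid.
have eqx : x = \prod_(i < n1) tnth b1 i ^+ tnth c1 i.
  by apply: (mulIg y); rewrite {2}eqy.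
have -> : a1 = c1.
  apply: uniq1; split=> // i.
  by have := lta (lshift n2 i); rewrite tnth_lshift tnth_mktuple.
have -> : a2 = c2.
  apply: uniq2; split=> // i.
  by have := lta (rshift n1 i); rewrite tnth_rshift tnth_mktuple.
apply: eq_from_tnth => i; rewrite -(splitK i).
by case: (split i) => j /=; rewrite ?tnth_lshift ?tnth_rshift tnth_mktuple.
Qed.

Lemma abelian_has_basis G : abelian G -> has_basis G.
Proof.
case/abelian_structure=> s defG _; elim: s G defG => [|x s IHs] G.
  by rewrite big_nil => /esym; apply: has_basis1.
rewrite big_cons => defG; have [[_ H _ defH] _ _ _] := dprodP defG.
rewrite defH in defG; have [_ mulG _ tiG] := dprodP defG.
apply: (has_basis_mulg mulG tiG); first exact: has_basis_cycle.
exact: IHs defH.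
Qed.

(** These are exactly the orders [m] and [2 * m] with [m] odd and cube-free, in a form that visibly
    passes to divisors, so that the induction applies to [K]. *)
Lemma cube_free_has_basis G :
  cube_free #|G| -> ~~ (4 %| #|G|) -> has_basis G.
Proof.
have [n] := ubnP #|G|; elim: n G => // n IHn G leGn cfG no4.
have [G1|ntG] := eqVneq (G : {set gT}) 1; first exact: has_basis1.
have gtG1 : 1 < #|G| by rewrite cardG_gt1.
pose p := pdiv #|G|; have p_pr : prime p by apply: pdiv_prime.
have [P sylP] := Sylow_exists p G.
have pP := pHall_pgroup sylP.
have leP2 : logn p #|P| <= 2.
  rewrite (card_Hall sylP) logn_part leqNgt -pfactor_dvdn //; exact: cfG.
have no4P : ~~ (4 %| #|P|).
  by apply: contra no4 => /dvdn_trans-> //; apply/cardSg/(pHall_sub sylP).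
have cPN := pdiv_Sylow_central sylP gtG1 erefl leP2 no4P.
have [K /normal_sub sKG [defG tiKP]] :=
  normal_complement_of_central_Sylow sylP cPN.
have basP : has_basis P by apply/abelian_has_basis/(p2group_abelian pP).
apply: (has_basis_mulg defG tiKP) => //; apply: IHn.
- rewrite ltnS in leGn; apply: leq_trans leGn; rewrite -defG TI_cardMg //.
  by rewrite ltn_Pmulr // (card_Hall sylP) p_part_gt1 pi_pdiv.
- move=> q q_pr; apply: contra (cfG q q_pr) => /dvdn_trans-> //.
  exact: cardSg.
by apply: contra no4 => /dvdn_trans-> //; apply: cardSg.
Qed.

End BasisProducts.

Theorem corollary2p4 (m : nat) (gT : finGroupType) (G : {group gT}) :
  odd m -> cube_free m -> #|G| = m \/ #|G| = 2 * m -> has_basis G.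
Proof.
move=> m_odd cfm oG.
have no2m : ~~ (2 %| m) by rewrite dvdn2 negbK.
apply: cube_free_has_basis; case: oG => ->.
- by [].
- move=> p p_pr; have [-> | p_odd] := even_prime p_pr.
    (* If 8 divides [2 * m] then 4 divides [m], which is odd. *)
    by rewrite (dvdn_pmul2l (p := 2) (d := 4)) //; apply: contra no2m; apply: dvdn_trans.
  by rewrite Gauss_dvdr ?cfm // coprimeXl // coprimen2.
- by apply: contra no2m; apply: dvdn_trans.
by rewrite (dvdn_pmul2l (p := 2) (d := 2)).
Qed.
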